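(* Let $d,k\geq 1$ be fixed positive integers and let $n=dk$. Suppose that $\mathcal{P}=\{P_a\}_{a=1}^d$ and $\mathcal{Q}=\{Q_b\}_{b=1}^d$ are families of rank-$k$ (orthogonal) projections defining $d$-outcome measurements on $\mathbb{C}^n$. Then the following conditions are equivalent: (i) $\mathcal{P}$ and $\mathcal{Q}$ are mutually unbiased measurements (MUMs). (ii) The algebras $\mathcal{A}=\mathrm{span}\{P_a : 1\le a\le d\}$ and $\mathcal{B}=\mathrm{span}\{Q_b : 1\le b\le d\}$ are quasiorthogonal, and for all $1\le a,b\le d$ the product $P_aQ_bP_a$ belongs to $\mathcal{A}$ and the product $Q_bP_aQ_b$ belongs to $\mathcal{B}$.
   Context: A $d$-outcome (von Neumann) measurement on $\mathbb{C}^n$ is a family $\{P_a\}_{a=1}^d$ of orthogonal projections in $M_n$ (the $n\times n$ complex matrices) with mutually orthogonal ranges and $\sum_{a=1}^dP_a=I_n$. Two $d$-outcome measurements $\{P_a\}_{a=1}^d$ and $\{Q_b\}_{b=1}^d$ on $\mathbb{C}^n$ are mutually unbiased measurements (MUMs) if $P_aQ_bP_a=\frac1dP_a$ and $Q_bP_aQ_b=\frac1dQ_b$ for all $1\le a,b\le d$. Unital $*$-subalgebras $\mathcal{A},\mathcal{B}\subseteq M_n$ are quasiorthogonal if $\mathrm{Tr}(AB)=\frac{\mathrm{Tr}(A)\mathrm{Tr}(B)}{n}$ for all $A\in\mathcal{A}$, $B\in\mathcal{B}$. *)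

(* Defs.v *)
From HB Require Import structures.
From mathcomp Require Import all_boot all_order all_algebra.
From mathcomp Require Import reals complex.

Set Implicit Arguments.
Unset Strict Implicit.
Unset Printing Implicit Defensive.

Import Order.TTheory GRing.Theory Num.Theory.

Local Open Scope ring_scope.
Local Open Scope sesquilinear_scope.

Definition orthogonal_projection (R : realType) (n : nat) (P : 'M[R[i]]_n) : Prop :=
  P *m P = P /\ P ^t* = P.

(* Matrices act on column vectors, so the range of [A] is [{A *m u}]. *)
Definition orthogonal_ranges (R : realType) (n : nat) (A B : 'M[R[i]]_n) : Prop :=
  forall u v : 'cV[R[i]]_n, (A *m u) ^t* *m (B *m v) = 0.

Record measurement (R : realType) (d n : nat) := Measurement {
  meas_proj :> 'I_d -> 'M[R[i]]_n;
  meas_projP : forall a, orthogonal_projection (meas_proj a);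
  meas_orth : forall a b, a != b -> orthogonal_ranges (meas_proj a) (meas_proj b);
  meas_sum : \sum_(a < d) meas_proj a = 1%:M
}.

Definition MUM (R : realType) (d n : nat) (P Q : measurement R d n) : Prop :=
  forall a b : 'I_d,
    P a *m Q b *m P a = (d%:R)^-1 *: P a /\
    Q b *m P a *m Q b = (d%:R)^-1 *: Q b.

(* Unital *-subalgebras of M_n; the library's [{aspace _}] is not available
   here because ['M_n] is a nontrivial ring only for [n] of the form [m.+1]. *)
Record starSubalg (R : realType) (n : nat) := StarSubalg {
  starSubalg_vspace :> {vspace 'M[R[i]]_n};
  starSubalg1 : 1%:M \in starSubalg_vspace;
  starSubalgM : forall A B, A \in starSubalg_vspace -> B \in starSubalg_vspace ->
    A *m B \in starSubalg_vspace;
  starSubalgJ : forall A, A \in starSubalg_vspace -> A ^t* \in starSubalg_vspace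
}.

Definition quasiorthogonal (R : realType) (n : nat) (A B : starSubalg R n) : Prop :=
  forall X Y : 'M[R[i]]_n, X \in (A : {vspace _}) -> Y \in (B : {vspace _}) ->
    \tr (X *m Y) = \tr X * \tr Y / n%:R.

Section MeasurementAlgebra.
Variables (R : realType) (d n : nat) (P : measurement R d n).

Lemma meas_mul a b : P a *m P b = if a == b then P a else 0.
Proof.
case: eqVneq => [<-|ab]; first by have [] := meas_projP P a.
have [_ Pa] := meas_projP P a.
apply/matrixP => i j.
have /matrixP/(_ 0 0) := meas_orth P ab (delta_mx i 0) (delta_mx j 0).
rewrite trmx_mul map_mxM Pa trmx_delta map_delta_mx.
by rewrite !mulmxA -(mulmxA (delta_mx 0 i)) -rowE -colE !mxE.
Qed.

Lemma mem_meas_span (A : 'M[R[i]]_n) :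
  reflect (exists c : 'I_d -> R[i], A = \sum_a c a *: P a)
          (A \in <<codom P>>%VS).
Proof.
apply: (iffP idP) => [|[c ->]]; last first.
  by apply: memv_suml => a _; apply/memvZ/memv_span/codom_f.
rewrite span_def big_image /= => /memv_sumP[v vP ->].
have vc a : exists c, v a == c *: P a by have /vlineP[c ->] := vP a isT; exists c.
exists (fun a => xchoose (vc a)).
by apply: eq_bigr => a _; apply/eqP/(xchooseP (vc a)).
Qed.

Fact meas_span1 : 1%:M \in <<codom P>>%VS.
Proof.
apply/mem_meas_span; exists (fun=> 1).
by rewrite -(meas_sum P); apply: eq_bigr => a _; rewrite scale1r.
Qed.

Fact meas_spanM A B : A \in <<codom P>>%VS -> B \in <<codom P>>%VS ->
  A *m B \in <<codom P>>%VS.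
Proof.
move=> /mem_meas_span[c ->] /mem_meas_span[e ->].
rewrite mulmx_suml; apply: memv_suml => a _.
rewrite mulmx_sumr; apply: memv_suml => b _.
rewrite -scalemxAl -scalemxAr meas_mul; do 2!apply: memvZ.
by case: eqP => _; rewrite ?mem0v// memv_span ?codom_f.
Qed.

Fact meas_spanJ A : A \in <<codom P>>%VS -> A ^t* \in <<codom P>>%VS.
Proof.
move=> /mem_meas_span[c ->].
rewrite linear_sum /= map_mx_sum; apply: memv_suml => a _.
rewrite linearZ /= map_mxZ; apply: memvZ.
by have [_ ->] := meas_projP P a; rewrite memv_span ?codom_f.
Qed.

Definition meas_alg : starSubalg R n :=
  @StarSubalg R n <<codom P>>%VS meas_span1 meas_spanM meas_spanJ.

End MeasurementAlgebra.

(* Main.v *)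
(** Compressing an element of span(P) by P_a keeps only its P_a-component, so a
    product P_a X P_a lying in span(P) is a multiple of P_a; the multiple is
    determined by the trace. Since Tr P_a = rank P_a = k, both conditions prescribe
    the same value Tr(P_a Q_b) = k/d = k^2/n. *)
Require Import Defs.
From mathcomp Require Import all_boot all_order all_algebra.
From mathcomp Require Import reals complex.
Import Order.TTheory GRing.Theory Num.Theory.
Local Open Scope ring_scope.

Lemma mxtrace_idem (F : fieldType) (n : nat) (A : 'M[F]_n) :
  A *m A = A -> \tr A = (\rank A)%:R.
Proof.
move=> AA; have rc1 : row_base A *m col_base A = 1%:M.
  apply: (row_free_inj (row_base_free A)).
  apply: (row_full_inj (col_base_full A)).
  by rewrite mul1mx -(mulmxA (row_base A)) mulmx_base mulmxA mulmx_base.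
by rewrite -[in LHS](mulmx_base A) mxtrace_mulC rc1 mxtrace1.
Qed.

Lemma mxtrace_meas (R : realType) (d n : nat) (P : measurement R d n) (a : 'I_d) :
  \tr (P a) = (\rank (P a))%:R.
Proof. by apply: mxtrace_idem; have [] := meas_projP P a. Qed.

Lemma mxtrace_compress (R : realType) (d n : nat) (P : measurement R d n)
    (a : 'I_d) (X : 'M[R[i]]_n) :
  \tr (P a *m X *m P a) = \tr (P a *m X).
Proof. by rewrite mxtrace_mulC mulmxA meas_mul eqxx. Qed.

Lemma compress_mem_span (R : realType) (d n : nat) (P : measurement R d n)
    (a : 'I_d) (X : 'M[R[i]]_n) :
  P a *m X *m P a \in <<codom P>>%VS -> \tr (P a) != 0 ->
  P a *m X *m P a = (\tr (P a *m X) / \tr (P a)) *: P a.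
Proof.
move=> /mem_meas_span[c PXP] trP.
have PXPa : P a *m X *m P a = c a *: P a.
  transitivity (P a *m (P a *m X *m P a)).
    by rewrite !mulmxA meas_mul eqxx.
  rewrite PXP mulmx_sumr (bigD1 a) //= big1 => [|e ea].
    by rewrite -scalemxAr meas_mul eqxx addr0.
  by rewrite -scalemxAr meas_mul eq_sym (negPf ea) scaler0.
by rewrite -mxtrace_compress PXPa mxtraceZ mulfK.
Qed.

Lemma quasiorthogonal_measP (R : realType) (d n : nat) (P Q : measurement R d n) :
  quasiorthogonal (meas_alg P) (meas_alg Q) <->
  forall a b : 'I_d, \tr (P a *m Q b) = \tr (P a) * \tr (Q b) / n%:R.
Proof.
split=> [qo a b|trPQ X Y /mem_meas_span[c ->] /mem_meas_span[e ->]].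
  by apply: qo; rewrite memv_span ?codom_f.
rewrite mulmx_suml !raddf_sum /= !mulr_suml; apply: eq_bigr => a _.
rewrite mulmx_sumr !raddf_sum /= mulr_sumr mulr_suml; apply: eq_bigr => b _.
rewrite -scalemxAl -scalemxAr !mxtraceZ trPQ.
by rewrite mulrACA !mulrA.
Qed.

Theorem theorem5p2 (R : realType) (d k n : nat) (hd : (1 <= d)%N) (hk : (1 <= k)%N)
    (hn : n = (d * k)%N) (P Q : measurement R d n)
    (hP : forall a : 'I_d, \rank (P a) = k)
    (hQ : forall b : 'I_d, \rank (Q b) = k) :
  MUM P Q <->
  (quasiorthogonal (meas_alg P) (meas_alg Q) /\
   forall a b : 'I_d,
     P a *m Q b *m P a \in (meas_alg P : {vspace 'M[R[i]]_n}) /\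
     Q b *m P a *m Q b \in (meas_alg Q : {vspace 'M[R[i]]_n})).
Proof.
have trP a : \tr (P a) = k%:R by rewrite mxtrace_meas hP.
have trQ b : \tr (Q b) = k%:R by rewrite mxtrace_meas hQ.
have k0 : k%:R != 0 :> R[i] by rewrite pnatr_eq0 -lt0n.
have kkn : k%:R * k%:R / n%:R = d%:R^-1 * k%:R :> R[i].
  by rewrite hn natrM invfM mulrACA divff // mulr1 mulrC.
rewrite quasiorthogonal_measP; split=> [mum|[trPQ mem] a b].
  split=> a b; have [PQP QPQ] := mum a b.
    by rewrite -mxtrace_compress PQP mxtraceZ trP trQ kkn.
  by rewrite PQP QPQ; split; apply/memvZ/memv_span/codom_f.
have [memP memQ] := mem a b.
have tr_ab : \tr (P a *m Q b) / k%:R = d%:R^-1.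
  by rewrite trPQ trP trQ kkn mulfK.
split; first by rewrite compress_mem_span ?trP ?tr_ab.
by rewrite compress_mem_span ?trQ // mxtrace_mulC tr_ab.
Qed.
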